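(* Let $N\ge1$ be an integer and let the sub-ADC offsets $o_0,\dots,o_{N-1}$ be i.i.d. real $\mathcal{N}(0,\sigma_{\mathbf{o}}^2)$ random variables with $\sigma_{\mathbf{o}}>0$. Let $P^{\mathrm{o}}_k$ be the single-sided offset spur power relative to full scale at frequency $kf_s/N$, for integers $0\le k\le N/2$. Then, for all $p\ge0$: (i) for $k=0$ and, if $N$ is even, also for $k=N/2$, $$\Pr\left(P^{\mathrm{o}}_k\le p\right)=\operatorname{erf}\left(\sqrt{\frac{Np}{4\sigma_{\mathbf{o}}^2}}\right);$$ (ii) for every integer $k$ with $0<k<N/2$, $$\Pr\left(P^{\mathrm{o}}_k\le p\right)=1-e^{-\frac{Np}{4\sigma_{\mathbf{o}}^2}}.$$
   Context: The normalized DFT of $\mathbf{o}$ is $\tilde o_k=\frac1N\sum_{n=0}^{N-1}e^{-2\pi j kn/N}o_n$, with $j$ the imaginary unit. An interleaved ADC of total sampling rate $f_s$ with offset sequence $\mathbf{o}$ has offset spurs at multiples of $f_s/N$ with amplitudes $\tilde o_k$. Powers are relative to that of a full-scale sine wave of amplitude $1$ (power $1/2$), giving a factor $2$; in the single-sided spectrum the conjugate bins $k$ and $N-k$ are merged, giving another factor $2$ for $0<k<N/2$. Thus $P^{\mathrm{o}}_k=2|\tilde o_k|^2$ for $k=0$ and (if $N$ is even) $k=N/2$, and $P^{\mathrm{o}}_k=4|\tilde o_k|^2$ for $0<k<N/2$. $\mathcal{N}(0,\sigma^2)$ is the zero-mean real Gaussian distribution of variance $\sigma^2$, and $\operatorname{erf}(x)=\frac{2}{\sqrt\pi}\int_0^x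 e^{-u^2}du$. *)

(* Defs.v *)
From HB Require Import structures.
From mathcomp Require Import all_boot all_order all_algebra.
From mathcomp Require Import all_classical all_reals all_analysis.
From mathcomp Require Import complex.

Set Implicit Arguments.
Unset Strict Implicit.
Unset Printing Implicit Defensive.

Import Order.TTheory GRing.Theory Num.Theory.
Import numFieldNormedType.Exports.

Local Open Scope classical_set_scope.
Local Open Scope ring_scope.

(* Mutual independence: the product rule holds over every subfamily. *)
Definition mutually_independent (d d' : measure_display)
    (T : measurableType d) (T' : measurableType d') (R : realType)
    (P : probability T R) (I : finType) (X : I -> {RV P >-> T'}) : Prop :=
  forall (J : {set I}) (B : I -> set T'),
    (forall i, measurable (B i)) ->
    P [set t | forall i, i \in J -> B i (X i t)] =
    (\prod_(i in J) P (X i @^-1` B i))%E.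

(* The law is compared on measurable sets only: measures are unconstrained on
   the others.  The second argument of [normal_prob] is the standard
   deviation. *)
Definition gaussian_rv (d : measure_display) (T : measurableType d)
    (R : realType) (P : probability T R) (m s : R) (X : {RV P >-> R}) : Prop :=
  forall A : set R, measurable A -> distribution P X A = normal_prob m s A.

(* The integral from 0 to x is oriented, hence the case split. *)
Definition erf (R : realType) (x : R) : R :=
  2 / Num.sqrt pi *
  (if 0 <= x then \int[lebesgue_measure]_(u in `[0, x]) expR (- u ^+ 2)
   else - \int[lebesgue_measure]_(u in `[x, 0]) expR (- u ^+ 2)).

Definition cexp (R : realType) (z : R[i]) : R[i] :=
  (expR (complex.Re z))%:C%C *
  Complex (cos (complex.Im z)) (sin (complex.Im z)).

Definition normalized_dft (R : realType) (N : nat) (o : 'I_N -> R) (k : nat) :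
    R[i] :=
  (N%:R)^-1 *
  \sum_(n < N) cexp (- (2 * (pi%:C)%C * 'i%C * k%:R * n%:R / N%:R))
    * (o n)%:C%C.

(* Power of the spur at k f_s / N relative to a sine wave of power 1/2, whence
   the factor 2; for 0 < k < N/2 the bins k and N - k are merged, whence the
   factor 4.  Only meaningful for 2 k <= N. *)
Definition offset_spur_power (R : realType) (N : nat) (o : 'I_N -> R)
    (k : nat) : R :=
  (if (k == 0%N) || (k.*2 == N) then 2 else 4) *
  ComplexField.Normc.normc (normalized_dft o k) ^+ 2.

(* Main.v *)
Require Import Defs.
From HB Require Import structures.
From mathcomp Require Import all_boot all_order all_algebra.
From mathcomp Require Import all_classical all_reals all_analysis.
From mathcomp Require Import measurable_realfun giry complex ring.

Set Implicit Arguments.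
Unset Strict Implicit.
Unset Printing Implicit Defensive.

Import Order.TTheory GRing.Theory Num.Theory.
Import numFieldNormedType.Exports.

Local Open Scope classical_set_scope.
Local Open Scope ring_scope.

(* The real and imaginary parts of N times the k-th DFT coefficient are, up to
   sign, the linear combinations U = sum_n cos(theta_n) o_n and
   V = sum_n sin(theta_n) o_n. By induction on the number of summands, the pair
   of two linear combinations of i.i.d. centred Gaussian variables has the law
   of (al x, be x + ga y) with x, y i.i.d. Gaussian, where al^2, al be and
   be^2 + ga^2 are the entries of the Gram matrix of the two coefficient
   vectors: adding one independent variable and rotating (x, y, z) restores the
   triangular form, because the product of Gaussian densities is invariant under
   rotations of the plane. The trigonometric sums give the Gram matrix
   diag(N, 0) for k = 0 and 2k = N, and diag(N/2, N/2) for 0 < 2k < N. The spur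
   power is thus a multiple of x^2, which yields erf, or of x^2 + y^2, which is
   exponentially distributed. *)

(** * Affine changes of variable and densities *)

Section lebesgue_affine.
Context {R : realType}.
Local Notation mu := (@lebesgue_measure R).
Local Open Scope ereal_scope.

Let affine (a b : R) : measurableTypeR R -> measurableTypeR R :=
  fun x => (a * x + b)%R.

Let measurable_affine (a b : R) : measurable_fun setT (affine a b).
Proof. by apply: measurable_funD => //; exact: measurable_funM. Qed.

(** Lebesgue measure is the only measure giving each interval []u, v]] its length, and the preimage
    of []u, v]] under the affine map has length [(v - u) / a], so the factor [a] restores it. *)
Let lebesgue_measure_affine (a b : R) (a0 : (0 < a)%R) (A : set R) :
  measurable A -> mu A = a%:E * pushforward mu (affine a b) A.
Proof.
move=> mA.
pose f : {mfun measurableTypeR R >-> measurableTypeR R} :=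
  HB.pack (affine a b) (isMeasurableFun.Build _ _ _ _ _ (measurable_affine a b)).
have := @lebesgue_measure_unique R
  (mscale (NngNum (ltW a0)) (pushforward mu f)).
apply => // _ [[u v]] _ <-.
rewrite -[RHS]/(a%:E * mu (affine a b @^-1` `]u, v])).
have -> : affine a b @^-1` `]u, v] = `]((u - b) / a)%R, ((v - b) / a)%R]%classic.
  apply/seteqP; split => x /=; rewrite /affine !in_itv/= ltr_pdivrMr// ler_pdivlMr//;
  by rewrite ltrBlDr lerBrDr ![(x * a)%R]mulrC.
rewrite !lebesgue_measure_itv/= !lte_fin.
rewrite ltr_pM2r ?invr_gt0// ltrD2r.
case: ifPn => uv; last by rewrite mule0.
rewrite -!EFinB -EFinM; congr EFin; field; by rewrite gt_eqF.
Qed.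

Let ge0_integral_affine_pos (f : R -> \bar R) (a b : R) : (0 < a)%R ->
  measurable_fun setT f -> (forall x, 0 <= f x) ->
  \int[mu]_x f x = a%:E * \int[mu]_x f (a * x + b)%R.
Proof.
move=> a0 mf f0.
pose g : {mfun measurableTypeR R >-> measurableTypeR R} :=
  HB.pack (affine a b) (isMeasurableFun.Build _ _ _ _ _ (measurable_affine a b)).
rewrite -[X in _ = _ * X]/(\int[mu]_(x in g @^-1` setT) (f \o g) x).
rewrite -ge0_integral_pushforward//.
rewrite -(ge0_integral_mscale (pushforward mu g) measurableT (NngNum (ltW a0)))//.
by apply: eq_measure_integral => A mA _; exact: lebesgue_measure_affine.
Qed.

(** A negative slope reduces to a positive one through the reflection of the line, which preserves
    Lebesgue measure; hence the absolute value. *)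
Lemma ge0_integral_affine (f : R -> \bar R) (a b : R) : (a != 0)%R ->
  measurable_fun setT f -> (forall x, 0 <= f x) ->
  \int[mu]_x f x = `|a|%:E * \int[mu]_x f (a * x + b)%R.
Proof.
move=> a0 mf f0.
have [a_gt0|a_lt0|/eqP] := ltgtP 0%R a; last by rewrite eq_sym (negbTE a0).
  by rewrite gtr0_norm//; exact: ge0_integral_affine_pos.
have mN : measurable_fun setT (-%R : measurableTypeR R -> measurableTypeR R).
  exact: oppr_measurable.
have mfN : measurable_fun setT (fun x : R => f (- x)%R).
  exact: (measurableT_comp mf).
transitivity (\int[mu]_x f (- x)%R).
  pose g : {mfun measurableTypeR R >-> measurableTypeR R} :=
    HB.pack (-%R : measurableTypeR R -> measurableTypeR R)
      (isMeasurableFun.Build _ _ _ _ _ mN).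
  rewrite -[RHS]/(\int[mu]_(x in g @^-1` setT) (f \o g) x).
  rewrite -ge0_integral_pushforward//.
  by apply: eq_measure_integral => A mA _; exact/esym/lebesgue_measureN.
rewrite (ge0_integral_affine_pos (a := (- a)%R) (- b)) ?oppr_gt0//.
rewrite ltr0_norm//; congr (_ * _); apply: eq_integral => x _; congr f.
by rewrite mulNr -opprD opprK.
Qed.

End lebesgue_affine.

Section density.
Context d (T : measurableType d) (R : realType).
Variables (mu nu : {measure set T -> \bar R}) (g : T -> R).
Local Open Scope ereal_scope.
Hypotheses (mg : measurable_fun setT g) (g0 : forall x, (0 <= g x)%R).
Hypothesis nuE : forall A, measurable A -> nu A = \int[mu]_(x in A) (g x)%:E.

Import HBNNSimple.

(** Both sides are linear over the level sets of [h], and on each level set the equality is the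
    hypothesis [nuE]. *)
Let nnsfun_integral_density (h : {nnsfun T >-> R}) :
  \int[nu]_x (h x)%:E = \int[mu]_x ((h x)%:E * (g x)%:E).
Proof.
under eq_integral do rewrite fimfunE -fsumEFin//.
rewrite ge0_integral_fsum//; last 2 first.
- by move=> y; exact/measurable_EFinP/measurable_funM.
- by move=> y x _; rewrite nnfun_muleindic_ge0.
transitivity (\sum_(k \in range h)
    \int[mu]_x ((k * \1_(h @^-1` [set k]) x)%:E * (g x)%:E)).
  apply: eq_fsbigr => k _.
  rewrite integralZl_indic_nnsfun//= integral_indic// setIT.
  under [RHS]eq_integral do rewrite EFinM -muleA.
  (* A constant leaves the integral of a nonnegative function only if it is nonnegative; a negative
     [k] is not a value of [h], so its level set is empty. *)
  have [k0|k0] := leP 0%R k; last first.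
    rewrite preimage_nnfun0// measure0 mule0 integral0_eq// => x _.
    by rewrite indic0 mul0e mule0.
  rewrite ge0_integralZl//=.
  - congr (_ * _); rewrite nuE// integral_mkcond; apply: eq_integral => x _.
    by rewrite patchE indicE; case: ifPn => _; rewrite ?mul1e ?mul0e.
  - apply: emeasurable_funM; exact/measurable_EFinP.
  - by move=> x _; rewrite -EFinM lee_fin mulr_ge0.
rewrite -ge0_integral_fsum//.
- apply: eq_integral => x _; rewrite fimfunE -fsumEFin// ge0_mule_fsuml//.
  by move=> k; rewrite nnfun_muleindic_ge0.
- move=> k; apply: emeasurable_funM; last exact/measurable_EFinP.
  exact/measurable_EFinP/measurable_funM.
- by move=> k x _; rewrite mule_ge0 ?lee_fin// -lee_fin nnfun_muleindic_ge0.
Qed.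

(** Monotone convergence on both sides along an increasing sequence of simple functions, for which
    the equality is already known. *)
Lemma ge0_integral_density (f : T -> \bar R) :
  measurable_fun setT f -> (forall x, 0 <= f x) ->
  \int[nu]_x f x = \int[mu]_x (f x * (g x)%:E).
Proof.
move=> mf f0; pose f_ := nnsfun_approx measurableT mf.
transitivity (limn (fun n => \int[nu]_x (f_ n x)%:E)).
  rewrite -monotone_convergence//.
  - apply: eq_integral => y _; apply/esym/cvg_lim => //.
    exact: cvg_nnsfun_approx.
  - by move=> n; exact/measurable_EFinP/measurable_funP.
  - by move=> n y _; rewrite lee_fin.
  - by move=> y _ m n mn; rewrite lee_fin; exact/lefP/nd_nnsfun_approx.
under eq_fun do rewrite nnsfun_integral_density.
rewrite -monotone_convergence//.
- apply: eq_integral => y _; apply/cvg_lim => //.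
  apply: cvgeZr => //; exact: cvg_nnsfun_approx.
- by move=> n; apply: emeasurable_funM; exact/measurable_EFinP.
- by move=> n y _; rewrite mule_ge0 ?lee_fin.
- move=> y _ m n mn; rewrite lee_wpmul2r ?lee_fin//.
  exact/lefP/nd_nnsfun_approx.
Qed.

End density.

(** * Rotation invariance of Gaussian pairs *)

Section plane_rotation.
Context {R : realType}.
Local Notation mu := (@lebesgue_measure R).
Local Open Scope ereal_scope.
Let V : measurableType _ := measurableTypeR R.

Lemma measurable_lin2 (a b : R) :
  measurable_fun setT (fun p : V * V => (a * p.1 + b * p.2)%R : V).
Proof. by apply: measurable_funD; apply: measurable_funM. Qed.

Lemma measurable_linmap2 (a b c e : R) :
  measurable_fun setT
    (fun p : V * V => ((a * p.1 + b * p.2)%R, (c * p.1 + e * p.2)%R) : V * V).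
Proof. by apply: measurable_fun_pair; exact: measurable_lin2. Qed.

Let lin (h : V * V -> \bar R) (a b c e : R) (p : V * V) :=
  h ((a * p.1 + b * p.2)%R, (c * p.1 + e * p.2)%R).

Let measurable_lin h a b c e : measurable_fun setT h ->
  measurable_fun setT (lin h a b c e).
Proof. by move=> mh; exact: (measurableT_comp mh (measurable_linmap2 _ _ _ _)). Qed.

Let tonelli (h : V * V -> \bar R) : measurable_fun setT h ->
  (forall p, 0 <= h p) ->
  \int[mu]_x \int[mu]_y h (x, y) = \int[mu]_y \int[mu]_x h (x, y).
Proof. by move=> mh h0; exact: fubini_tonelli. Qed.

(** For fixed [y], the first coordinate is an affine function of [x] with slope [a]; Tonelli makes
    the integral over [x] the inner one. *)
Let scale1 (h : V * V -> \bar R) (a b : R) : measurable_fun setT h ->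
  (forall p, 0 <= h p) -> (a != 0)%R ->
  \int[mu]_x \int[mu]_y lin h a b 0 1 (x, y) =
  (`|a|^-1)%:E * \int[mu]_x \int[mu]_y h (x, y).
Proof.
move=> mh h0 a0.
rewrite (tonelli mh h0) (@tonelli (lin h a b 0 1))//; last 2 first.
- exact: measurable_lin.
- by move=> p; exact: h0.
rewrite -ge0_integralZl//; last 2 first.
- exact: (measurable_fun_fubini_tonelli_G h mh h0).
- by move=> y _; exact: integral_ge0.
apply: eq_integral => y _.
transitivity ((`|a|^-1)%:E * (`|a|%:E * \int[mu]_x h ((a * x + b * y)%R, y))).
  rewrite muleA -EFinM mulVf ?normr_eq0// mul1e.
  by apply: eq_integral => x _; rewrite /lin/= mul0r add0r mul1r.
congr (_ * _); apply/esym.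
exact: (@ge0_integral_affine R (fun x => h (x, y)) a (b * y) a0
  (measurable_fun_pair1 y mh) (fun x => h0 _)).
Qed.

Let scale2 (h : V * V -> \bar R) (a b : R) : measurable_fun setT h ->
  (forall p, 0 <= h p) -> (a != 0)%R ->
  \int[mu]_x \int[mu]_y lin h 1 0 b a (x, y) =
  (`|a|^-1)%:E * \int[mu]_x \int[mu]_y h (x, y).
Proof.
move=> mh h0 a0; pose g (p : V * V) := h (p.2, p.1).
have mg : measurable_fun setT g 
  by apply: (measurableT_comp mh); exact: measurable_fun_pair.
have g0 p : 0 <= g p by exact: h0.
rewrite (tonelli mh h0) -[X in _ = _ * X]/(\int[mu]_x \int[mu]_y g (x, y)).
rewrite -(scale1 b mg g0 a0).
transitivity (\int[mu]_y \int[mu]_x lin h 1 0 b a (x, y)).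
  by apply: (@tonelli (lin h 1 0 b a)); [exact: measurable_lin|move=> p; exact: h0].
apply: eq_integral => y _; apply: eq_integral => x _.
by rewrite /lin /g/= !mul0r !mul1r add0r addr0 addrC.
Qed.

(** For [c] nonzero the rotation is [(x, y) -> (c x + s y, y)] followed by
    [(u, v) -> (u, (v - s u) / c)]. These triangular maps have determinants [c] and [1 / c], so the
    two scaling factors cancel. *)
Lemma ge0_integral_rotation (c s : R) (h : V * V -> \bar R) :
  (c ^+ 2 + s ^+ 2 = 1)%R -> measurable_fun setT h -> (forall p, 0 <= h p) ->
  \int[mu]_x \int[mu]_y h ((c * x + s * y)%R, (- s * x + c * y)%R) =
  \int[mu]_x \int[mu]_y h (x, y).
Proof.
move=> cs1 mh h0.
(* When [c = 0] the factorisation breaks down, but then [s] is 1 or -1 and the rotation is an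
   exchange of the coordinates, handled by Tonelli, together with sign changes. *)
have [c0|c0] := eqVneq c 0%R.
  have ns : (`|s| = 1)%R.
    have /eqP : (s ^+ 2 = 1)%R by rewrite -cs1 c0 expr0n/= add0r.
    by rewrite sqrf_eq1 => /orP[]/eqP ->; rewrite ?normrN normr1.
  have s0 : (s != 0)%R by rewrite -normr_gt0 ns.
  have ns0 : (- s != 0)%R by rewrite oppr_eq0.
  pose g := lin h s 0 0 1.
  have mg : measurable_fun setT g by exact: measurable_lin.
  have g0 p : 0 <= g p by exact: h0.
  transitivity (\int[mu]_x \int[mu]_y lin g 1 0 0 (- s)%R (x, y)); last first.
    by rewrite scale2// scale1// normrN ns invr1 !mul1e.
  transitivity (\int[mu]_y \int[mu]_x lin g 1 0 0 (- s)%R (x, y)); last first.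
    apply/esym; apply: (@tonelli (lin g 1 0 0 (- s)%R)).
    - exact: measurable_lin.
    - by move=> p; exact: g0.
  apply: eq_integral => y _; apply: eq_integral => x _.
  by rewrite /lin /g /lin/= c0 !mul0r !mul1r !add0r !addr0.
have cV0 : (c^-1 != 0)%R by rewrite invr_eq0.
pose g := lin h 1 0 (- s / c)%R (c^-1)%R.
have mg : measurable_fun setT g by exact: measurable_lin.
have g0 p : 0 <= g p by exact: h0.
transitivity (\int[mu]_x \int[mu]_y lin g c s 0 1 (x, y)); last first.
  rewrite scale1// scale2// muleA -EFinM normfV invrK mulVf ?normr_eq0//.
  by rewrite mul1e.
apply: eq_integral => x _; apply: eq_integral => y _.
rewrite /lin /g /lin/= !mul0r !mul1r add0r addr0; congr (h (_, _)).
have -> : (c * y = c ^+ 2 * y / c)%R by field.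
have -> : (c ^+ 2 = 1 - s ^+ 2)%R by rewrite -cs1 addrK.
by field.
Qed.

End plane_rotation.

Section normal_rotation.
Context {R : realType}.
Variable sigma : R.
Hypothesis sigma0 : sigma != 0.
Local Open Scope ereal_scope.
Let V : measurableType _ := measurableTypeR R.
Local Notation mu := (@lebesgue_measure R).
Local Notation gamma := (@normal_prob R 0 sigma).

(** The joint density of two independent centred Gaussian variables, written through [x^2 + y^2] so
    that its rotation invariance is visible. *)
Definition normal_pdf2 (p : V * V) : R :=
  (normal_peak sigma ^+ 2 * expR (- (p.1 ^+ 2 + p.2 ^+ 2) / (sigma ^+ 2 *+ 2)))%R.

Lemma normal_pdf2_ge0 p : (0 <= normal_pdf2 p)%R.
Proof. by rewrite mulr_ge0 ?sqr_ge0 ?expR_ge0. Qed.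

Lemma measurable_normal_pdf2 : measurable_fun setT normal_pdf2.
Proof.
apply: measurable_funM => //; apply: measurableT_comp => //.
apply: measurable_funM => //; apply: measurableT_comp => //.
by apply: measurable_funD; exact: measurable_funX.
Qed.

Lemma normal_pdf2E x y :
  normal_pdf2 (x, y) = (normal_pdf 0 sigma x * normal_pdf 0 sigma y)%R.
Proof.
rewrite /normal_pdf2 !normal_pdfE// /normal_fun !subr0 mulrACA -expr2 -expRD.
by rewrite -mulrDl opprD.
Qed.

Lemma normal_pdf2_rotation (c s x y : R) : (c ^+ 2 + s ^+ 2 = 1)%R ->
  normal_pdf2 ((c * x + s * y)%R, (- s * x + c * y)%R) = normal_pdf2 (x, y).
Proof.
move=> cs1; rewrite /normal_pdf2/=.
suff -> : ((c * x + s * y) ^+ 2 + (- s * x + c * y) ^+ 2 = x ^+ 2 + y ^+ 2)%R by [].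
by rewrite -[RHS]mul1r -cs1; ring.
Qed.

Lemma ge0_integral_normal (f : V -> \bar R) :
  measurable_fun setT f -> (forall x, 0 <= f x) ->
  \int[gamma]_x f x = \int[mu]_x (f x * (normal_pdf 0 sigma x)%:E).
Proof.
move=> mf f0; apply: ge0_integral_density => //.
- exact: measurable_normal_pdf.
- by move=> x; exact: normal_pdf_ge0.
Qed.

Lemma ge0_integral_normal2 (h : V * V -> \bar R) :
  measurable_fun setT h -> (forall p, 0 <= h p) ->
  \int[gamma]_x \int[gamma]_y h (x, y) =
  \int[mu]_x \int[mu]_y (h (x, y) * (normal_pdf2 (x, y))%:E).
Proof.
move=> mh h0.
have mpdf : measurable_fun setT (fun x : V => (normal_pdf 0 sigma x)%:E).
  by apply/measurable_EFinP; exact: measurable_normal_pdf.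
have mhx x : measurable_fun setT (fun y : V => h (x, y)).
  exact: (measurable_fun_pair2 (f := h)).
rewrite ge0_integral_normal; last 2 first.
- exact: (measurable_fun_fubini_tonelli_F (m2 := gamma) h mh h0).
- by move=> x; exact: integral_ge0.
apply: eq_integral => x _.
rewrite ge0_integral_normal// -ge0_integralZr//.
- by apply: eq_integral => y _; rewrite normal_pdf2E -muleA -EFinM mulrC.
- by apply: emeasurable_funM => //; exact: mhx.
- by move=> y _; rewrite mule_ge0// lee_fin normal_pdf_ge0.
- by rewrite lee_fin normal_pdf_ge0.
Qed.

(** Once written against Lebesgue measure, the integral has a density that the rotation leaves
    unchanged, and plane Lebesgue integrals are themselves rotation invariant. *)
Lemma normal_rotation (c s : R) (h : V * V -> \bar R) :
  (c ^+ 2 + s ^+ 2 = 1)%R -> measurable_fun setT h -> (forall p, 0 <= h p) ->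
  \int[gamma]_x \int[gamma]_y h ((c * x + s * y)%R, (- s * x + c * y)%R) =
  \int[gamma]_x \int[gamma]_y h (x, y).
Proof.
move=> cs1 mh h0.
pose g (p : V * V) := h ((c * p.1 + s * p.2)%R, (- s * p.1 + c * p.2)%R).
have mg : measurable_fun setT g.
  exact: (measurableT_comp mh (measurable_linmap2 _ _ _ _)).
have g0 p : 0 <= g p by exact: h0.
pose k p := h p * (normal_pdf2 p)%:E.
transitivity (\int[mu]_x \int[mu]_y (g (x, y) * (normal_pdf2 (x, y))%:E)).
  exact: (ge0_integral_normal2 mg g0).
transitivity (\int[mu]_x \int[mu]_y k (x, y)); last first.
  exact/esym/(ge0_integral_normal2 mh h0).
have mk : measurable_fun setT k.
  apply: emeasurable_funM => //; apply/measurable_EFinP.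
  exact: measurable_normal_pdf2.
have k0 p : 0 <= k p by rewrite mule_ge0// lee_fin normal_pdf2_ge0.
rewrite -(ge0_integral_rotation cs1 mk k0).
apply: eq_integral => x _; apply: eq_integral => y _; rewrite /k /g.
by rewrite normal_pdf2_rotation.
Qed.

End normal_rotation.

(** * Triangular form of a pair of Gaussian combinations *)

Section gaussian_pair.
Context {R : realType}.
Variable sigma : R.
Hypothesis sigma0 : sigma != 0.
Local Open Scope ereal_scope.
Let V : measurableType _ := measurableTypeR R.
Local Notation gamma := (@normal_prob R 0 sigma).

(** Provides the rotation that sends the vector [(a, b)] to [(r, 0)]; [c] and [s] stand for the
    cosine and sine of its angle, and the null vector gets angle 0. *)
Lemma polar_decomposition (a b : R) :
  exists r c s : R, [/\ a = (r * c)%R, b = (r * s)%R & (c ^+ 2 + s ^+ 2 = 1)%R].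
Proof.
have [ab0|ab0] := eqVneq (a ^+ 2 + b ^+ 2)%R 0%R.
  exists 0%R, 1%R, 0%R; move/eqP: ab0.
  rewrite paddr_eq0 ?sqr_ge0// !sqrf_eq0 => /andP[/eqP -> /eqP ->].
  by rewrite !mul0r; split => //; ring.
pose r := Num.sqrt (a ^+ 2 + b ^+ 2).
have r2 : (r ^+ 2 = a ^+ 2 + b ^+ 2)%R by rewrite sqr_sqrtr// addr_ge0 ?sqr_ge0.
have r0 : r != 0%R by rewrite -sqrf_eq0 r2.
exists r, (a / r)%R, (b / r)%R; split; [by field|by field|].
by rewrite !exprMn -mulrDl -r2 exprVn divff// sqrf_eq0.
Qed.

Lemma integral_normal_cst (r : \bar R) : \int[gamma]_x r = r.
Proof.
by rewrite integral_cst// [X in _ * X](@probability_setT _ _ _ gamma) mule1.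
Qed.

Let tonelli (h : V * V -> \bar R) : measurable_fun setT h ->
  (forall p, 0 <= h p) ->
  \int[gamma]_x \int[gamma]_y h (x, y) = \int[gamma]_y \int[gamma]_x h (x, y).
Proof. by move=> mh h0; exact: (fubini_tonelli (m1 := gamma) (m2 := gamma)). Qed.

Let tonelli3 (h : V * V * V -> \bar R) : measurable_fun setT h ->
  (forall p, 0 <= h p) ->
  \int[gamma]_x \int[gamma]_y \int[gamma]_z h (x, y, z) =
  \int[gamma]_y \int[gamma]_x \int[gamma]_z h (x, y, z).
Proof.
move=> mh h0; apply: (@tonelli (fun p => \int[gamma]_z h (p, z))).
- exact: (measurable_fun_fubini_tonelli_F (m2 := gamma) h mh h0).
- by move=> p; exact: integral_ge0.
Qed.

Let measurable_lin3 (F : V * V -> \bar R) (a1 a2 a3 b1 b2 b3 : R) :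
  measurable_fun setT F ->
  measurable_fun setT (fun p : V * V * V =>
    F ((a1 * p.1.1 + a2 * p.1.2 + a3 * p.2)%R,
       (b1 * p.1.1 + b2 * p.1.2 + b3 * p.2)%R)).
Proof.
move=> mF; apply: (measurableT_comp mF).
by apply: measurable_fun_pair; apply: measurable_funD => //;
  try apply: measurable_funD => //; apply: measurable_funM => //;
  apply: measurableT_comp => //.
Qed.

Let measurable_aff2 (F : V * V -> \bar R) (a1 a2 a3 b1 b2 b3 : R) :
  measurable_fun setT F ->
  measurable_fun setT (fun p : V * V =>
    F ((a1 * p.1 + a2 * p.2 + a3)%R, (b1 * p.1 + b2 * p.2 + b3)%R)).
Proof.
move=> mF; apply: (measurableT_comp mF).
by apply: measurable_fun_pair; apply: measurable_funD => //; exact: measurable_lin2.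
Qed.

(* Two rotations bring the three Gaussian variables of the left-hand side to
   the triangular form of the right-hand side: the first one, in the plane
   (x, z), clears z from the first coordinate; the second one, in the plane
   (y, z), clears it from the second. *)
Lemma gaussian_pair_add (al be ga a b : R) :
  exists al' be' ga' : R,
  [/\ (al' ^+ 2 = al ^+ 2 + a ^+ 2)%R, (al' * be' = al * be + a * b)%R,
      (be' ^+ 2 + ga' ^+ 2 = be ^+ 2 + ga ^+ 2 + b ^+ 2)%R &
  forall F : V * V -> \bar R, measurable_fun setT F -> (forall p, 0 <= F p) ->
    \int[gamma]_x \int[gamma]_y \int[gamma]_z
      F ((al * x + a * z)%R, (be * x + ga * y + b * z)%R) =
    \int[gamma]_x \int[gamma]_y F ((al' * x)%R, (be' * x + ga' * y)%R)].
Proof.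
have [r [c [s [alE aE cs1]]]] := polar_decomposition al a.
(* With [u = c x + s z] and [w = - s x + c z], the first form is [r u], and [be x + b z] becomes
   [be' u + de w]. The second rotation then merges [ga y + de w] into one variable with coefficient
   [ga']. *)
pose be' := (be * c + b * s)%R; pose de := (- s * be + c * b)%R.
have [ga' [c' [s' [gaE deE cs1']]]] := polar_decomposition ga de.
exists r, be', ga'; split.
- by rewrite alE aE -[LHS]mulr1 -cs1; ring.
- by rewrite alE aE /be'; ring.
- have -> : (ga' ^+ 2 = ga ^+ 2 + de ^+ 2)%R.
    by rewrite gaE deE -[LHS]mulr1 -cs1'; ring.
  have -> : (be ^+ 2 + ga ^+ 2 + b ^+ 2 =
      (be ^+ 2 + b ^+ 2) * (c ^+ 2 + s ^+ 2) + ga ^+ 2)%R by rewrite cs1; ring.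
  by rewrite /be' /de; ring.
- move=> F mF F0.
  pose G1 (p : V * V * V) := F ((al * p.1.1 + 0 * p.1.2 + a * p.2)%R,
    (be * p.1.1 + ga * p.1.2 + b * p.2)%R).
  pose G2 (p : V * V * V) := F ((0 * p.1.1 + r * p.1.2 + 0 * p.2)%R,
    (ga * p.1.1 + be' * p.1.2 + de * p.2)%R).
  transitivity (\int[gamma]_x \int[gamma]_y \int[gamma]_z G1 (x, y, z)).
    apply: eq_integral => x _; apply: eq_integral => y _.
    by apply: eq_integral => z _; rewrite /G1/= mul0r addr0.
  (* The rotation acts on the two inner integrals, so [y] is moved outside to rotate in the plane
     [(x, z)]; afterwards [x] is moved outside for the plane [(y, z)]. *)
  transitivity (\int[gamma]_y \int[gamma]_x \int[gamma]_z G1 (x, y, z)).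
    by apply: tonelli3 => [|p]; [exact: measurable_lin3|exact: F0].
  transitivity (\int[gamma]_y \int[gamma]_x \int[gamma]_z G2 (y, x, z)).
    apply: eq_integral => y _.
    pose h (p : V * V) := F ((r * p.1 + 0 * p.2 + 0)%R,
      (be' * p.1 + de * p.2 + ga * y)%R).
    have mh : measurable_fun setT h by exact: measurable_aff2.
    have h0 p : 0 <= h p by exact: F0.
    transitivity (\int[gamma]_x \int[gamma]_z h (x, z)); last first.
      apply: eq_integral => x _; apply: eq_integral => z _.
      by rewrite /h /G2/=; congr (F (_, _)); ring.
    rewrite -(normal_rotation sigma0 cs1 mh h0).
    apply: eq_integral => x _; apply: eq_integral => z _.
    rewrite /h /G1/=; congr (F (_, _)); first by rewrite alE aE; ring.
    (* The identity holds only modulo [c^2 + s^2 = 1], so the factor 1 is inserted where [ring]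
       needs it. *)
    rewrite /be' /de -[(be * x)%R]mulr1 -[(b * z)%R]mulr1 -cs1; ring.
  transitivity (\int[gamma]_x \int[gamma]_y \int[gamma]_z G2 (y, x, z)).
    by apply: tonelli3 => [|p]; [exact: measurable_lin3|exact: F0].
  apply: eq_integral => x _.
  pose h (p : V * V) := F ((0 * p.1 + 0 * p.2 + r * x)%R,
    (ga' * p.1 + 0 * p.2 + be' * x)%R).
  have mh : measurable_fun setT h by exact: measurable_aff2.
  have h0 p : 0 <= h p by exact: F0.
  transitivity (\int[gamma]_y \int[gamma]_z h (y, z)).
    rewrite -(normal_rotation sigma0 cs1' mh h0).
    apply: eq_integral => y _; apply: eq_integral => z _.
    by rewrite /h /G2/= gaE deE; congr (F (_, _)); ring.
  apply: eq_integral => y _.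
  (* The integrand no longer depends on [z], and [gamma] has total mass 1. *)
  rewrite -[RHS]integral_normal_cst.
  by apply: eq_integral => z _; rewrite /h/=; congr (F (_, _)); ring.
Qed.

End gaussian_pair.

(** * Linear combinations of independent Gaussian variables *)

Section joint_law.
Context d d1 d2 (T : measurableType d) (T1 : measurableType d1)
  (T2 : measurableType d2) (R : realType) (P : probability T R).
Variables (m1 : {measure set T1 -> \bar R})
  (m2 : {sigma_finite_measure set T2 -> \bar R}).
Variables (W : T -> T1) (Y : T -> T2) (E : set T).
Hypotheses (mW : measurable_fun setT W) (mY : measurable_fun setT Y).
Hypothesis mE : measurable E.
Local Open Scope ereal_scope.

(** As functions of [C], both sides are measures: the image of [P] restricted to [E], and the
    product measure scaled by [P E]. They agree on measurable rectangles, which generate the product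
    sigma-algebra and are stable under intersection, and the first one is finite. *)
Lemma joint_law_product :
  (forall A B, measurable A -> measurable B ->
    P (W @^-1` A `&` Y @^-1` B `&` E) = m1 A * m2 B * P E) ->
  forall C, measurable C ->
    P ((fun t => (W t, Y t)) @^-1` C `&` E) = (m1 \x m2) C * P E.
Proof.
move=> rectP C mC.
have mWY : measurable_fun setT (fun t => (W t, Y t)) by exact: measurable_fun_pair.
pose f : {mfun T >-> (T1 * T2)%type} :=
  HB.pack (fun t => (W t, Y t)) (isMeasurableFun.Build _ _ _ _ _ mWY).
have PE0 : (0 <= fine (P E))%R by exact: fine_ge0.
have PE_fin : (fine (P E))%:E = P E by rewrite fineK// fin_num_measure.
pose n1_ : {measure set (T1 * T2)%type -> \bar R} := pushforward (mrestr P mE) f.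
pose n1 := n1_ mWY.
pose n2 : {measure set (T1 * T2)%type -> \bar R} := mscale (NngNum PE0) (m1 \x m2).
rewrite -[LHS]/(n1 C) -[RHS](_ : n2 C = _); last first.
  by rewrite /n2 /= /mscale/= PE_fin muleC.
apply: (measure_unique [set A `*` B | A in measurable & B in measurable]
  (fun _ => setT)) => //.
- by rewrite measurable_prod_measurableType.
- move=> _ _ [A1 mA1 [B1 mB1 <-]] [A2 mA2 [B2 mB2 <-]].
  exists (A1 `&` A2); first exact: measurableI.
  by exists (B1 `&` B2); [exact: measurableI|rewrite setXI].
- by move=> _; exists setT => //; exists setT => //; rewrite setXTT.
- exact: bigcup_const.
- move=> _ [A mA [B mB <-]].
  rewrite /n1 /n1_ /n2/= /mscale/= PE_fin product_measure1E// muleC -rectP//.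
- move=> _; rewrite /n1 /n1_/= /pushforward /mrestr preimage_setT setTI.
  by rewrite -ge0_fin_numE// fin_num_measure.
Qed.

End joint_law.

Section gaussian_combination.
Context d (T : measurableType d) (R : realType) (P : probability T R).
Variable sigma : R.
Hypothesis sigma0 : sigma != 0.
Variables (I : finType) (X : I -> {RV P >-> R}).
Hypotheses (X_indep : mutually_independent X)
  (X_gauss : forall i, gaussian_rv 0 sigma (X i)).
Variables a b : I -> R.
Local Open Scope ereal_scope.
Let V : measurableType _ := measurableTypeR R.
Local Notation gamma := (@normal_prob R 0 sigma).

Let mX i : measurable_fun setT (X i : T -> V).
Proof. exact: (measurable_funPT (X i)). Qed.

Let comb (s : seq I) (t : T) : V * V :=
  ((\sum_(i <- s) a i * X i t)%R, (\sum_(i <- s) b i * X i t)%R).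

Let measurable_comb s : measurable_fun setT (comb s).
Proof.
by apply: measurable_fun_pair; apply: measurable_sum => i;
  apply: measurable_funM => //; exact: mX.
Qed.

(** Carrying arbitrary constraints on the variables outside [s] through the induction encodes their
    independence from the combination over [s]. *)
Let rest (s : seq I) (B : I -> set V) : set T :=
  [set t | forall i, i \notin s -> B i (X i t)].

Let restE s B : rest s B =
  [set t | forall i, i \in [set j | j \notin s]%SET -> B i (X i t)].
Proof.
by apply/seteqP; split => t /= Bt i; have := Bt i; rewrite inE.
Qed.

Let measurable_rest s B : (forall i, measurable (B i)) -> measurable (rest s B).
Proof.
move=> mB.
apply: (fin_bigcap_measurable (D := [set i | i \notin s])
  (F := fun i => X i @^-1` B i)) => [|i _]; first exact: finite_finset.
by rewrite -[_ @^-1` _]setTI; exact: mX.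
Qed.

Let rest_cons i s (A : set V) (B : I -> set V) : i \notin s ->
  rest s (fun j => if j == i then A else B j) = X i @^-1` A `&` rest (i :: s) B.
Proof.
move=> is_; apply/seteqP; split => t /=.
  move=> At; split; first by have := At i is_; rewrite eqxx.
  move=> j; rewrite inE negb_or => /andP[ji js].
  by have := At j js; rewrite (negbTE ji).
move=> [Ait Bt] j js; case: eqVneq => [->//|ji].
by apply: Bt; rewrite inE negb_or ji.
Qed.

(** The product rule is applied to both events, over the complement of [s] and over that of
    [i :: s]; the two products differ by the factor of [i]. *)
Let rest_indep i s (A : set V) (B : I -> set V) : i \notin s -> measurable A ->
  (forall j, measurable (B j)) ->
  P (X i @^-1` A `&` rest (i :: s) B) = gamma A * P (rest (i :: s) B).
Proof.
move=> is_ mA mB; rewrite -rest_cons// !restE.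
pose B' j := if j == i then A else B j.
have mB' j : measurable (B' j) by rewrite /B'; case: ifP.
rewrite (X_indep [set j | j \notin i :: s]%SET mB).
transitivity (\prod_(j in [set j | j \notin s]%SET) P (X j @^-1` B' j)).
  exact: (X_indep _ mB').
rewrite (bigD1 i)/=; last by rewrite inE.
rewrite {1}/B' eqxx; congr (_ * _); first exact: (X_gauss i mA).
apply: eq_big => [j|j]; first by rewrite !inE negb_or andbC.
by rewrite /B' !inE => /andP[_ /negbTE ->].
Qed.

(** Induction on [s]. On the event [rest (i :: s) B], the pair made of the combination over [s] and
    [X i] has a product law, up to the factor [P (rest (i :: s) B)]; adding the contribution of
    [X i] is the situation of [gaussian_pair_add]. *)
Let gaussian_combination_rest (s : seq I) : uniq s ->
  exists al be ga : R,
  [/\ (al ^+ 2 = \sum_(i <- s) a i ^+ 2)%R,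
      (al * be = \sum_(i <- s) a i * b i)%R,
      (be ^+ 2 + ga ^+ 2 = \sum_(i <- s) b i ^+ 2)%R &
  forall (A : set (V * V)) (B : I -> set V), measurable A ->
    (forall i, measurable (B i)) ->
    P (comb s @^-1` A `&` rest s B) =
    (\int[gamma]_x \int[gamma]_y (\1_A ((al * x)%R, (be * x + ga * y)%R))%:E) *
    P (rest s B)].
Proof.
elim: s => [_|i s IH /= /andP[is_ us]].
  exists 0%R, 0%R, 0%R; split; rewrite ?big_nil ?mul0r ?expr0n ?addr0//.
  move=> A B mA mB.
  (* The empty combination is the constant [(0, 0)], so its law is a Dirac mass and only the
     membership of [(0, 0)] in [A] matters. *)
  have -> : \int[gamma]_x \int[gamma]_y (\1_A ((0 * x)%R, (0 * x + 0 * y)%R))%:E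
      = (\1_A (0%R, 0%R))%:E.
    transitivity (\int[gamma]_x \int[gamma]_y (\1_A (0%R, 0%R) : R)%:E).
      apply: eq_integral => x _; apply: eq_integral => y _ /=.
      by rewrite !mul0r addr0.
    by rewrite !integral_normal_cst.
  rewrite indicE; case: (boolP (_ \in A)) => [/set_mem A0|/negP A0].
    rewrite mul1e; congr (P _); apply/seteqP; split => [t []//|t Bt]; split => //.
    by rewrite /comb/= !big_nil.
  rewrite mul0e (_ : _ `&` _ = set0) ?measure0//; apply/seteqP; split => // t [At _].
  by apply: A0; apply/mem_set; move: At; rewrite /comb/= !big_nil.
have [al [be [ga [aa ab bb IHs]]]] := IH us.
have [al' [be' [ga' [aa' ab' bb' addE]]]] :=
  gaussian_pair_add sigma0 al be ga (a i) (b i).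
exists al', be', ga'; split.
- by rewrite aa' aa big_cons addrC.
- by rewrite ab' ab big_cons addrC.
- by rewrite bb' bb big_cons addrC.
move=> A B mA mB.
have mE := measurable_rest (i :: s) mB.
set E := rest (i :: s) B in mE *.
pose m (p : V * V) : V * V := ((al * p.1 + 0 * p.2)%R, (be * p.1 + ga * p.2)%R).
have mm : measurable_fun setT m by exact: measurable_linmap2.
pose gamma2 : subprobability (V * V)%type R :=
  product_subprobability (gamma : subprobability V R, gamma : subprobability V R).
(* [nu] is the triangular law given by the induction hypothesis. As an image of a product of
   subprobabilities it is finite, so its product with [gamma] and Tonelli are available. *)
pose nu : subprobability (V * V)%type R := giry_map mm gamma2.
have nuE F : measurable_fun setT F -> (forall p, 0 <= F p) ->
    \int[nu]_p F p =
    \int[gamma]_x \int[gamma]_y F ((al * x)%R, (be * x + ga * y)%R).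
  move=> mF F0; transitivity (\int[gamma2]_p F (m p)); first exact: giry_int_map.
  transitivity (\int[gamma]_x \int[gamma]_y F (m (x, y))).
    apply: (fubini_tonelli1 (m1 := gamma) (m2 := gamma) (F \o m)) => [|p]; last exact: F0.
    exact: measurableT_comp.
  apply: eq_integral => x _; apply: eq_integral => y _.
  by rewrite /m/= mul0r addr0.
have m1A (A' : set (V * V)) : measurable A' ->
    measurable_fun setT (fun p => (\1_A' p : R)%:E).
  by move=> mA'; apply/measurable_EFinP; exact: measurable_indic.
have m10 (A' : set (V * V)) p : 0 <= (\1_A' p : R)%:E by rewrite lee_fin.
have jointE : forall C, measurable C ->
    P ((fun t => (comb s t, X i t : V)) @^-1` C `&` E) = (nu \x gamma) C * P E.
  apply: joint_law_product => // A1 B1 mA1 mB1.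
  (* The condition on [X i] is absorbed into the constraints outside [s], which the induction
     hypothesis allows, and is then split off again by independence. *)
  rewrite -setIA -rest_cons// IHs//; last by move=> j; case: ifP.
  rewrite -[RHS]/(nu A1 * gamma B1 * P E).
  have -> : nu A1 = \int[gamma]_x \int[gamma]_y
      (\1_A1 ((al * x)%R, (be * x + ga * y)%R))%:E.
    rewrite -[X in nu X]setIT -integral_indic//.
    exact: (nuE (fun p => (\1_A1 p)%:E) (m1A _ mA1) (m10 A1)).
  rewrite -muleA; congr (_ * _).
  by rewrite (rest_cons _ _ is_); exact: rest_indep.
pose l (q : V * V * V) : V * V := ((q.1.1 + a i * q.2)%R, (q.1.2 + b i * q.2)%R).
have ml : measurable_fun setT l.
  by apply: measurable_fun_pair; apply: measurable_funD => //;
    [apply: measurableT_comp|apply: measurable_funM|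
     apply: measurableT_comp|apply: measurable_funM].
have mC : measurable (l @^-1` A) by rewrite -[_ @^-1` _]setTI; exact: ml.
rewrite (_ : comb (i :: s) @^-1` A =
    (fun t => (comb s t, X i t : V)) @^-1` (l @^-1` A)); last first.
  apply/seteqP; split => t; rewrite /comb /l/= !big_cons;
  by rewrite [(a i * _ + _)%R]addrC [(b i * _ + _)%R]addrC.
rewrite jointE//; congr (_ * _).
transitivity (\int[gamma]_x \int[gamma]_y \int[gamma]_z (\1_A
    ((al * x + a i * z)%R, (be * x + ga * y + b i * z)%R) : R)%:E); last first.
  exact: (addE (fun p => (\1_A p)%:E) (m1A _ mA) (m10 A)).
pose g (q : V * V * V) : \bar R := (\1_A (l q))%:E.
have mg : measurable_fun setT g by exact: (measurableT_comp (m1A _ mA) ml).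
have g0 q : 0 <= g q by rewrite lee_fin.
transitivity (\int[nu \x gamma]_q g q).
  transitivity ((nu \x gamma) (l @^-1` A `&` setT)); first by rewrite setIT.
  exact/esym/(integral_indic (nu \x gamma) measurableT mC).
transitivity (\int[nu]_p \int[gamma]_z g (p, z)).
  exact: (fubini_tonelli1 (m1 := nu) (m2 := gamma)).
apply: (nuE (fun p => \int[gamma]_z g (p, z))).
- exact: (measurable_fun_fubini_tonelli_F (m2 := gamma) g mg g0).
- by move=> p; exact: integral_ge0.
Qed.

(** The list enumerates all of [I] and every constraint set is the whole line, so the auxiliary
    event has probability 1. *)
Lemma gaussian_combination : exists al be ga : R,
  [/\ (al ^+ 2 = \sum_i a i ^+ 2)%R,
      (al * be = \sum_i a i * b i)%R,
      (be ^+ 2 + ga ^+ 2 = \sum_i b i ^+ 2)%R &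
  forall A : set (V * V), measurable A ->
    P [set t | A ((\sum_i a i * X i t)%R, (\sum_i b i * X i t)%R)] =
    \int[gamma]_x \int[gamma]_y (\1_A ((al * x)%R, (be * x + ga * y)%R))%:E].
Proof.
have [al [be [ga [aa ab bb H]]]] := gaussian_combination_rest (index_enum_uniq I).
exists al, be, ga; split => // A mA.
have := H A (fun _ => setT) mA (fun _ => measurableT).
have -> : rest (index_enum I) (fun _ => setT) = setT by apply/seteqP; split.
by rewrite setIT probability_setT mule1.
Qed.

End gaussian_combination.

(** * Gaussian measure of intervals and disks *)

Section even_integrals.
Context {R : realType}.
Local Notation mu := (@lebesgue_measure R).
Local Open Scope ereal_scope.

(** The reflection carries the negative half-line to the positive one; the endpoint 0 is
    negligible. *)
Lemma ge0_even_integralT (f : R -> \bar R) : measurable_fun setT f ->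
  (forall x, 0 <= f x) -> (forall x, f (- x)%R = f x) ->
  \int[mu]_x f x = 2%:E * \int[mu]_(x in `[0%R, +oo[) f x.
Proof.
move=> mf f0 fN.
have negE : \int[mu]_(x in `]-oo, 0%R[) f x = \int[mu]_(x in `[0%R, +oo[) f x.
  rewrite ge0_integration_by_substitution0//.
  rewrite integral_itv_bndo_bndc; last exact: measurable_funTS.
  by apply: eq_integral => x _; rewrite fN.
have -> : [set: R] = `]-oo, 0%R[%classic `|` `[0%R, +oo[%classic.
  by rewrite -itv_bndbnd_setU// set_itvE.
rewrite ge0_integral_setU//=.
- by rewrite negE [in RHS]mule_natl mule2n.
- exact: measurable_funTS.
- apply/disj_setPS => x [] /=; rewrite !in_itv/= andbT => x0.
  by rewrite leNgt x0.
Qed.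

Lemma ge0_even_integral_sqr_le (f : R -> R) (t : R) : (0 <= t)%R ->
  measurable_fun setT f -> (forall x, 0 <= f x)%R -> (forall x, f (- x) = f x)%R ->
  \int[mu]_x ((x ^+ 2 <= t)%R%:R * f x)%:E =
  2%:E * \int[mu]_(x in `[0%R, Num.sqrt t]) (f x)%:E.
Proof.
move=> t0 mf f0 fN; rewrite ge0_even_integralT.
- congr (_ * _); rewrite [LHS]integral_mkcond [RHS]integral_mkcond.
  apply: eq_integral => x _; rewrite !patchE !mem_setE !in_itv/= andbT.
  have [x0|//] := leP 0%R x.
  rewrite -{1}[t]sqr_sqrtr// ler_pXn2r ?nnegrE ?sqrtr_ge0//.
  by case: leP; rewrite ?mul1r ?mul0r.
- apply/measurable_EFinP; apply: measurable_funM => //.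
  apply: (measurableT_comp (f := fun b : bool => b%:R : R)) => //.
  exact: measurable_fun_ler.
- by move=> x; rewrite lee_fin mulr_ge0.
- by move=> x; rewrite sqrrN fN.
Qed.

(** Twice the half-line integral [pi / 2]. This is the angular factor of the radial integral
    below. *)
Lemma integral_oneDsqrV : \int[mu]_x ((1 + x ^+ 2)^-1)%R%:E = pi%:E.
Proof.
rewrite ge0_even_integralT.
- rewrite (integral0y_oneDsqr R) -EFinM; congr EFin; by field.
- apply/measurable_EFinP; apply: continuous_measurable_fun.
  exact: continuous_oneDsqrV.
- by move=> x; rewrite lee_fin invr_ge0 addr_ge0 ?sqr_ge0.
- by move=> x; rewrite sqrrN.
Qed.

End even_integrals.

(** * Integrals of radial functions in the plane *)

Section radial_integral.
Context {R : realType}.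
Local Notation mu := (@lebesgue_measure R).
Local Open Scope ereal_scope.
Let V : measurableType _ := measurableTypeR R.

(* The substitution y = x u turns x^2 + y^2 into x^2 (1 + u^2). *)
Lemma ge0_integral_radial (phi : V -> \bar R) : measurable_fun setT phi ->
  (forall r, 0 <= phi r) ->
  \int[mu]_x \int[mu]_y phi (x ^+ 2 + y ^+ 2)%R =
  pi%:E * \int[mu]_w (`|w|%:E * phi (w ^+ 2)%R).
Proof.
move=> mphi phi0.
pose g (p : V * V) := `|p.1|%:E * phi (p.1 ^+ 2 * (1 + p.2 ^+ 2))%R.
have mg : measurable_fun setT g.
  apply: emeasurable_funM.
    by apply/measurable_EFinP; exact: measurableT_comp.
  apply: (measurableT_comp mphi); apply: measurable_funM.
    exact: measurable_funX.
  by apply: measurable_funD => //; exact: measurable_funX.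
have g0 p : 0 <= g p by rewrite mule_ge0.
pose h (p : V * V) := phi (p.1 ^+ 2 + p.2 ^+ 2)%R.
have mh : measurable_fun setT h.
  apply: (measurableT_comp mphi).
  by apply: measurable_funD; exact: measurable_funX.
have h0 p : 0 <= h p by exact: phi0.
pose psi w := `|w|%:E * phi (w ^+ 2)%R.
have mpsi : measurable_fun setT psi.
  apply: emeasurable_funM; first by apply/measurable_EFinP; exact: normr_measurable.
  by apply: (measurableT_comp mphi); exact: measurable_funX.
have psi0 w : 0 <= psi w by rewrite mule_ge0.
transitivity (\int[mu]_x \int[mu]_u g (x, u)).
  (* The substitution [y = x u] degenerates at [x = 0], so the inner integrals are compared only
     outside the null set [{0}]. *)
  apply: ge0_ae_eq_integral => //.
  - exact: (measurable_fun_fubini_tonelli_F (m2 := mu) h mh h0).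
  - exact: (measurable_fun_fubini_tonelli_F (m2 := mu) g mg g0).
  - by move=> x _; exact: integral_ge0.
  - by move=> x _; exact: integral_ge0.
  exists [set 0%R]; split => //; first exact: lebesgue_measure_set1.
  move=> x /= H; apply/eqP; apply/negPn/negP => x0; apply: H => _.
  transitivity (`|x|%:E * \int[mu]_u phi (x ^+ 2 + (x * u + 0) ^+ 2)%R).
    apply: (ge0_integral_affine (f := fun y => phi (x ^+ 2 + y ^+ 2)%R)) => //.
    exact: (measurable_fun_pair2 (f := h)).
  rewrite -ge0_integralZl//.
  - apply: eq_integral => u _; rewrite /g/=; congr (_ * phi _); ring.
  - apply: (measurableT_comp mphi); apply: measurable_funD => //.
    by apply: measurable_funX; apply: measurable_funD => //; exact: measurable_funM.
transitivity (\int[mu]_u \int[mu]_x g (x, u)).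
  exact: (fubini_tonelli (m1 := mu) (m2 := mu)).
(* For fixed [u], substituting [w = s x] with [s^2 = 1 + u^2] turns the inner integral into
   [(1 + u^2)^-1] times the integral of [psi]; the first factor integrates to [pi]. *)
rewrite -integral_oneDsqrV -ge0_integralZr//.
- apply: eq_integral => u _.
  have u1 : (0 < 1 + u ^+ 2)%R by rewrite ltr_pwDl ?sqr_ge0.
  pose s := Num.sqrt (1 + u ^+ 2).
  have s0 : (0 < s)%R by rewrite sqrtr_gt0.
  have s2 : (s ^+ 2 = 1 + u ^+ 2)%R by rewrite sqr_sqrtr// ltW.
  rewrite (ge0_integral_affine (f := psi) (a := s) 0%R)//; last by rewrite gt_eqF.
  rewrite -/psi muleA -EFinM gtr0_norm// -ge0_integralZl//.
  + apply: eq_integral => x _; rewrite /g /psi/= addr0 muleA -EFinM.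
    congr (_%:E * phi _); last by rewrite exprMn s2 mulrC.
    by rewrite normrM (gtr0_norm s0) -s2; field; rewrite gt_eqF.
  + by apply: (measurableT_comp mpsi); exact: measurable_funD.
  + by rewrite lee_fin mulr_ge0 ?invr_ge0 ?(ltW u1) ?(ltW s0).
- by apply/measurable_EFinP; apply: continuous_measurable_fun; exact: continuous_oneDsqrV.
- by move=> u _; rewrite lee_fin invr_ge0 addr_ge0 ?sqr_ge0.
- by apply: integral_ge0 => w _; exact: psi0.
Qed.

End radial_integral.

Section normal_events.
Context {R : realType}.
Variable sigma : R.
Hypothesis sigma0 : 0 < sigma.
Local Open Scope ereal_scope.
Local Notation mu := (@lebesgue_measure R).
Local Notation gamma := (@normal_prob R 0 sigma).
Let V : measurableType _ := measurableTypeR R.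

Let sigma_neq0 : (sigma != 0)%R. Proof. by rewrite gt_eqF. Qed.

Let normal_peak2 : (normal_peak sigma ^+ 2 = (2 * pi * sigma ^+ 2)^-1)%R.
Proof.
rewrite /normal_peak exprVn sqr_sqrtr; first by rewrite -mulr_natr; congr (_^-1)%R; ring.
by rewrite mulrn_wge0// mulr_ge0 ?sqr_ge0 ?pi_ge0.
Qed.

Let normal_pdf0E (w : R) : normal_pdf 0 sigma w =
  (normal_peak sigma * expR (- (w ^+ 2) / (sigma ^+ 2 *+ 2)))%R.
Proof. by rewrite normal_pdfE// /normal_fun subr0. Qed.

Lemma is_derive_normal_pdf (w : R) :
  is_derive w 1%R (normal_pdf 0 sigma) (- (w / sigma ^+ 2) * normal_pdf 0 sigma w)%R.
Proof.
pose e (w : R) : R := (- (sigma ^+ 2 *+ 2)^-1 * w ^+ 2)%R.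
have pdfE : normal_pdf 0 sigma = (fun v => normal_peak sigma * (expR \o e) v)%R.
  by apply/funext => v; rewrite normal_pdf0E /e/=; congr (_ * expR _)%R; ring.
have de : is_derive w 1%R e (- (sigma ^+ 2 *+ 2)^-1 * (w *+ 2))%R.
  apply: is_derive_eq; rewrite /GRing.scale/=; ring.
have dexp := @is_derive1_comp R expR e w _ _ (is_derive_expR (e w)) de.
rewrite pdfE.
apply: is_derive_eq.
rewrite /GRing.scale/=; field.
by rewrite sigma_neq0.
Qed.

Lemma integral_idM_normal_pdf (s : R) : (0 <= s)%R ->
  \int[mu]_(x in `[0%R, s]) (x * normal_pdf 0 sigma x)%:E =
  (sigma ^+ 2 * (normal_pdf 0 sigma 0 - normal_pdf 0 sigma s))%:E.
Proof.
(* The fundamental theorem of calculus is applied on a nondegenerate interval, so [s = 0] is settled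
   first. *)
rewrite le_eqVlt => /predU1P[<-|s0].
  by rewrite set_itv1 integral_set1 subrr mulr0.
(* An antiderivative of [w] times the density, since the density has logarithmic derivative
   [- w / sigma^2]. *)
pose F (w : R) : R := (- sigma ^+ 2 * normal_pdf 0 sigma w)%R.
have dF (w : R) : is_derive w 1%R F (w * normal_pdf 0 sigma w)%R.
  have dpdf := is_derive_normal_pdf w.
  apply: is_derive_eq; rewrite /GRing.scale/=; field.
  by rewrite sigma_neq0.
have cF : continuous F.
  move=> w; apply: differentiable_continuous; apply/derivable1_diffP.
  exact: ex_derive.
rewrite (@continuous_FTC2 _ _ F)//.
- by rewrite -EFinB /F; congr EFin; ring.
- apply: continuous_subspaceT => w; apply: continuousM; first exact: cvg_id.
  exact: continuous_normal_pdf.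
- split.
  + by move=> w _; exact: ex_derive.
  + by apply: cvg_at_right_filter; exact: cF.
  + by apply: cvg_at_left_filter; exact: cF.
- by move=> w _; rewrite derive1E; exact: derive_val.
Qed.

(** The radial formula leaves a one-dimensional integral of [|w|] times a Gaussian, which has an
    elementary primitive. *)
Lemma normal_disk (t : R) : (0 <= t)%R ->
  \int[gamma]_x \int[gamma]_y ((x ^+ 2 + y ^+ 2 <= t)%R%:R : R)%:E =
  (1 - expR (- t / (sigma ^+ 2 *+ 2)))%:E.
Proof.
move=> t0.
have mind : measurable_fun setT (fun r : V => (r <= t)%R%:R : R).
  apply: (measurableT_comp (f := fun b : bool => b%:R : R)) => //.
  exact: measurable_fun_ler.
pose h (p : V * V) : \bar R := ((p.1 ^+ 2 + p.2 ^+ 2 <= t)%R%:R : R)%:E.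
have mh : measurable_fun setT h.
  apply/measurable_EFinP; apply: (measurableT_comp mind).
  by apply: measurable_funD; exact: measurable_funX.
have h0 p : 0 <= h p by rewrite lee_fin.
transitivity (\int[mu]_x \int[mu]_y (h (x, y) * (normal_pdf2 sigma (x, y))%:E)).
  exact: (ge0_integral_normal2 sigma_neq0 mh h0).
pose phi (r : V) : \bar R := ((r <= t)%R%:R *
  (normal_peak sigma ^+ 2 * expR (- r / (sigma ^+ 2 *+ 2))))%:E.
have mphi : measurable_fun setT phi.
  apply/measurable_EFinP; apply: measurable_funM => //.
  apply: measurable_funM => //; apply: measurableT_comp => //.
  by apply: measurable_funM.
have phi0 r : 0 <= phi r.
  by rewrite lee_fin mulr_ge0// mulr_ge0 ?sqr_ge0 ?expR_ge0.
transitivity (\int[mu]_x \int[mu]_y phi (x ^+ 2 + y ^+ 2)%R).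
  by apply: eq_integral => x _; apply: eq_integral => y _; rewrite -EFinM.
rewrite (ge0_integral_radial mphi phi0).
(* One of the two peak factors is absorbed into the one-dimensional density, the other stays as a
   constant. *)
pose f (w : R) := (normal_peak sigma * (`|w| * normal_pdf 0 sigma w))%R.
transitivity (pi%:E * \int[mu]_w ((w ^+ 2 <= t)%R%:R * f w)%:E).
  congr (_ * _); apply: eq_integral => w _.
  rewrite /phi -EFinM /f normal_pdf0E; congr EFin; ring.
rewrite ge0_even_integral_sqr_le//; last 3 first.
- apply: measurable_funM => //; apply: measurable_funM => //.
  exact: measurable_normal_pdf.
- by move=> w; rewrite mulr_ge0 ?normal_peak_ge0// mulr_ge0 ?normal_pdf_ge0.
- by move=> w; rewrite /f normrN !normal_pdf0E sqrrN.
transitivity (pi%:E * (2%:E * ((normal_peak sigma)%:E *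
    \int[mu]_(x in `[0%R, Num.sqrt t]) (x * normal_pdf 0 sigma x)%:E))).
  congr (_ * (_ * _)); rewrite -ge0_integralZl//.
  - apply: eq_integral => w; rewrite inE/= in_itv/= => /andP[w0 _].
    by rewrite /f ger0_norm// -EFinM.
  - apply/measurable_EFinP; apply: measurable_funM => //.
    by apply: measurable_funTS; exact: measurable_normal_pdf.
  - move=> w; rewrite /= in_itv/= => /andP[w0 _].
    by rewrite lee_fin mulr_ge0// normal_pdf_ge0.
  - by rewrite lee_fin normal_peak_ge0.
rewrite integral_idM_normal_pdf ?sqrtr_ge0// -!EFinM; congr EFin.
rewrite !normal_pdf0E sqr_sqrtr// expr0n/= oppr0 mul0r expR0.
(* The leading constant [2 pi sigma^2 normal_peak^2] equals 1. *)
transitivity (2 * pi * sigma ^+ 2 * normal_peak sigma ^+ 2 *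
  (1 - expR (- t / (sigma ^+ 2 *+ 2))))%R; first by ring.
rewrite normal_peak2 mulfV ?mul1r// mulf_neq0//.
  by rewrite mulf_neq0// gt_eqF// pi_gt0.
by rewrite expf_neq0.
Qed.

Lemma normal_sqr_le (t : R) : (0 <= t)%R ->
  \int[gamma]_x ((x ^+ 2 <= t)%R%:R : R)%:E =
  (erf (Num.sqrt (t / (sigma ^+ 2 *+ 2))))%:E.
Proof.
(* The substitution [x = a u] turns [x^2 / (2 sigma^2)] into [u^2]; the peak times [a] becomes [c],
   half of the constant of [erf]. *)
move=> t0; pose a := (sigma * Num.sqrt 2)%R; pose c := ((Num.sqrt pi)^-1 : R)%R.
have sqrt2_gt0 : (0 < Num.sqrt (2 : R))%R by rewrite sqrtr_gt0.
have a0 : (0 < a)%R by rewrite mulr_gt0.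
have a2 : (a ^+ 2 = sigma ^+ 2 *+ 2)%R by rewrite exprMn sqr_sqrtr// mulr_natr.
have ca : (a * normal_peak sigma = c)%R.
  rewrite /normal_peak -mulrnAl -a2 sqrtrM ?sqr_ge0// sqrtr_sqr gtr0_norm//.
  by rewrite invfM mulrA mulfV ?mul1r// gt_eqF.
have mind (u : R) : measurable_fun setT (fun x : V => (x ^+ 2 <= u)%R%:R : R).
  apply: (measurableT_comp (f := fun b : bool => b%:R : R)) => //.
  by apply: measurable_fun_ler => //; exact: measurable_funX.
transitivity (\int[mu]_x (((x ^+ 2 <= t)%R%:R : R)%:E * (normal_pdf 0 sigma x)%:E)).
  apply: (@ge0_integral_normal _ sigma
    (fun x : V => ((x ^+ 2 <= t)%R%:R : R)%:E)) => [|x]; last by rewrite lee_fin.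
  by apply/measurable_EFinP; exact: mind.
pose f (x : R) : \bar R := ((x ^+ 2 <= t)%R%:R * normal_pdf 0 sigma x)%:E.
have mf : measurable_fun setT f.
  apply/measurable_EFinP; apply: measurable_funM; first exact: mind.
  exact: measurable_normal_pdf.
have f0 x : 0 <= f x by rewrite lee_fin mulr_ge0// normal_pdf_ge0.
transitivity (\int[mu]_x f x); first by apply: eq_integral => x _.
rewrite (ge0_integral_affine 0%R (lt0r_neq0 a0) mf f0) -ge0_integralZl//; last first.
  by apply: (measurableT_comp mf); exact: measurable_funD.
have mg : measurable_fun setT (fun x : V => expR (- x ^+ 2)).
  exact: measurable_gauss_fun.
transitivity (\int[mu]_u ((u ^+ 2 <= t / (sigma ^+ 2 *+ 2))%R%:R *
    (c * expR (- u ^+ 2)))%:E).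
  apply: eq_integral => u _.
  rewrite /f addr0 gtr0_norm// -EFinM normal_pdf0E exprMn a2 -ca.
  rewrite ler_pdivlMr ?pmulrn_lgt0 ?exprn_gt0// [(_ * u ^+ 2)%R]mulrC.
  rewrite -mulNr mulfK; last by rewrite gt_eqF// pmulrn_lgt0// exprn_gt0.
  by congr EFin; ring.
have c0 : (0 <= c)%R by rewrite invr_ge0 sqrtr_ge0.
rewrite ge0_even_integral_sqr_le//; last 4 first.
- by rewrite divr_ge0// pmulrn_lge0// sqr_ge0.
- exact: measurable_funM.
- by move=> u; rewrite mulr_ge0 ?expR_ge0.
- by move=> u; rewrite sqrrN.
set r := Num.sqrt _.
rewrite /erf sqrtr_ge0 !EFinM -muleA.
transitivity (2%:E * (c%:E * \int[mu]_(x in `[0%R, r]) (expR (- x ^+ 2))%:E)).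
  congr (_ * _); rewrite -ge0_integralZl//.
  by apply/measurable_EFinP; exact: measurable_funTS.
(* [erf] uses a real-valued integral, so finiteness is needed: the integrand is continuous on a
   compact segment. *)
rewrite -/c; congr (_ * (_ * _)); rewrite /Rintegral fineK//.
apply: integrable_fin_num => //.
apply: continuous_compact_integrable; first exact: segment_compact.
by apply: continuous_subspaceT; exact: continuous_gauss_fun.
Qed.

End normal_events.

(** * Discrete Fourier transform *)

Section dft.
Context {R : realType}.

(** By product-to-sum, [2 sin (h/2) cos (n h) = sin (n h + h/2) - sin (n h - h/2)], a difference of
    consecutive terms. *)
Lemma telescope_cos (N : nat) (h : R) :
  2 * sin (h / 2) * (\sum_(n < N) cos (n%:R * h)) =
  sin (N%:R * h - h / 2) + sin (h / 2).
Proof.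
pose g n := sin (n%:R * h - h / 2).
transitivity (\sum_(0 <= n < N) (g n.+1 - g n)).
  rewrite big_distrr/= big_mkord; apply: eq_bigr => n _.
  have hE : n.+1%:R * h - h / 2 = n%:R * h + h / 2.
    by rewrite -[n.+1%:R]natr1; field.
  by rewrite /g hE sinD sinB; ring.
by rewrite telescope_sumr// /g mul0r add0r sinN opprK.
Qed.

Lemma telescope_sin (N : nat) (h : R) :
  2 * sin (h / 2) * (\sum_(n < N) sin (n%:R * h)) =
  cos (h / 2) - cos (N%:R * h - h / 2).
Proof.
pose g n := - cos (n%:R * h - h / 2).
transitivity (\sum_(0 <= n < N) (g n.+1 - g n)).
  rewrite big_distrr/= big_mkord; apply: eq_bigr => n _.
  have hE : n.+1%:R * h - h / 2 = n%:R * h + h / 2.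
    by rewrite -[n.+1%:R]natr1; field.
  by rewrite /g hE cosD cosB; ring.
by rewrite telescope_sumr// /g mul0r add0r cosN opprK addrC.
Qed.

Definition dft_angle (N k n : nat) : R := 2 * pi * k%:R * n%:R / N%:R.

Lemma dft_angle0 N n : dft_angle N 0 n = 0.
Proof. by rewrite /dft_angle mulr0 !mul0r. Qed.

(** In the bin at half the length, every angle is a multiple of [pi]. *)
Lemma sin_dft_angle_half N n : (0 < N)%N -> sin (dft_angle N.*2 N n) = 0.
Proof.
move=> N0; have -> : dft_angle N.*2 N n = n%:R * pi.
  by rewrite /dft_angle -mul2n natrM; field; rewrite pnatr_eq0 -lt0n.
elim: n => [|n IH]; first by rewrite mul0r sin0.
by rewrite -[n.+1%:R]natr1 mulrDl mul1r sinDpi IH oppr0.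
Qed.

(** * Orthogonality of the sampled cosines and sines *)

Section double_angle.
Variables (N k : nat).
Hypotheses (k0 : (0 < k)%N) (kN : (k.*2 < N)%N).
Let h : R := dft_angle N k 1 *+ 2.

Let N0 : (N%:R : R) != 0.
Proof. by rewrite pnatr_eq0 -lt0n (leq_ltn_trans _ kN). Qed.

(** Here [0 < 2k < N] enters: it places [h / 2 = 2 pi k / N] strictly between 0 and [pi], so the
    telescoped sums can be divided by [sin (h / 2)]. *)
Let h_half_gt0 : 0 < sin (h / 2).
Proof.
have -> : h / 2 = 2 * pi * k%:R / N%:R.
  by rewrite /h /dft_angle; field; rewrite N0.
have Ngt0 : 0 < (N%:R : R) by rewrite ltr0n (leq_ltn_trans _ kN).
apply: sin_gt0_pi; rewrite divr_gt0 ?mulr_gt0 ?pi_gt0 ?Ngt0 ?ltr0n//=.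
rewrite ltr_pdivrMr//.
have -> : 2 * pi * k%:R = pi * (k.*2)%:R :> R by rewrite -mul2n natrM; ring.
by rewrite ltr_pM2l ?pi_gt0// ltr_nat.
Qed.

Let h_half_neq0 : 2 * sin (h / 2) != 0.
Proof. by rewrite mulf_neq0 ?gt_eqF. Qed.

Let Nh : N%:R * h = (pi *+ 2) *+ k.*2.
Proof.
have -> : h = 4 * pi * k%:R / N%:R by rewrite /h /dft_angle; ring.
rewrite mulrC divfK// -mulrnA -[RHS]mulr_natr natrM -muln2 natrM; ring.
Qed.

Let angleE n : dft_angle N k n *+ 2 = n%:R * h.
Proof. by rewrite /h /dft_angle; field; rewrite N0. Qed.

(** [N h] is a multiple of [2 pi], so the two boundary terms of the telescoped sum cancel. *)
Let sum_cos0 : \sum_(n < N) cos (dft_angle N k n *+ 2) = 0.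
Proof.
under eq_bigr do rewrite angleE.
apply: (mulfI h_half_neq0); rewrite mulr0 telescope_cos Nh.
rewrite [_ *+ _ - _]addrC (periodicn (sinD2pi (R:=R))).
by rewrite sinN addNr.
Qed.

Let sum_sin0 : \sum_(n < N) sin (dft_angle N k n *+ 2) = 0.
Proof.
under eq_bigr do rewrite angleE.
apply: (mulfI h_half_neq0); rewrite mulr0 telescope_sin Nh.
rewrite [_ *+ _ - _]addrC (periodicn (cosD2pi (R:=R))).
by rewrite cosN subrr.
Qed.

Lemma sum_cos_sqr : \sum_(n < N) cos (dft_angle N k n) ^+ 2 = N%:R / 2.
Proof.
transitivity (\sum_(n < N) (2^-1 + cos (dft_angle N k n *+ 2) / 2)).
  by apply: eq_bigr => n _; rewrite cos_mulr2n; field.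
by rewrite big_split/= -big_distrl/= sum_cos0 mul0r addr0 sumr_const card_ord mulr_natl.
Qed.

Lemma sum_sin_sqr : \sum_(n < N) sin (dft_angle N k n) ^+ 2 = N%:R / 2.
Proof.
under eq_bigr do rewrite sin2cos2.
by rewrite big_split/= sumrN sum_cos_sqr sumr_const card_ord; field.
Qed.

Lemma sum_cos_sin :
  \sum_(n < N) cos (dft_angle N k n) * sin (dft_angle N k n) = 0.
Proof.
transitivity (\sum_(n < N) (sin (dft_angle N k n *+ 2) / 2)).
  by apply: eq_bigr => n _; rewrite sin_mulr2n; field.
by rewrite -big_distrl/= sum_sin0 mul0r.
Qed.

End double_angle.

(** Each exponent is purely imaginary, so the coefficient splits into a cosine sum and minus a sine
    sum, both scaled by [1 / N]. *)
Lemma normc_dft_sqr (N : nat) (o : 'I_N -> R) (k : nat) :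
  ComplexField.Normc.normc (normalized_dft o k) ^+ 2 =
  (N%:R)^-1 ^+ 2 * ((\sum_(n < N) cos (dft_angle N k n) * o n) ^+ 2 +
                    (\sum_(n < N) sin (dft_angle N k n) * o n) ^+ 2).
Proof.
have argE (n : 'I_N) :
    (- (2 * (pi%:C)%C * 'i%C * k%:R * n%:R / N%:R))%R = Complex 0 (- dft_angle N k n).
  have -> : (- (2 * (pi%:C)%C * 'i%C * k%:R * n%:R / N%:R) =
      (- dft_angle N k n)%:C%C * 'i%C)%R.
    rewrite /dft_angle rmorphN !rmorphM/= fmorphV !rmorph_nat; ring.
  by apply/eqP; rewrite eq_complex/=; apply/andP; split; apply/eqP; ring.
have -> : normalized_dft o k =
    Complex ((N%:R)^-1 * \sum_(n < N) cos (dft_angle N k n) * o n)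
     (- ((N%:R)^-1 * \sum_(n < N) sin (dft_angle N k n) * o n)).
  rewrite /normalized_dft.
  have -> : \sum_(n < N) cexp (- (2 * (pi%:C)%C * 'i%C * k%:R * n%:R / N%:R))
      * (o n)%:C%C = Complex (\sum_(n < N) cos (dft_angle N k n) * o n)
        (\sum_(n < N) - (sin (dft_angle N k n) * o n)).
    (* The complex sum and its real and imaginary parts are followed together, term by term. *)
    apply: (big_ind3 (fun z x y => z = Complex x y)) => //.
      by move=> _ x1 y1 _ x2 y2 -> ->.
    move=> n _; rewrite argE /cexp/= expR0 cosN sinN.
    by apply/eqP; rewrite eq_complex/=; apply/andP; split; apply/eqP; ring.
  have -> : (N%:R^-1 : R[i]) = ((N%:R)^-1)%:C%C by rewrite fmorphV rmorph_nat.
  rewrite sumrN; apply/eqP; rewrite eq_complex/=.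
  by apply/andP; split; apply/eqP; ring.
rewrite /ComplexField.Normc.normc sqr_sqrtr ?addr_ge0 ?sqr_ge0//; ring.
Qed.

End dft.

(** * Law of the spur power *)

Lemma offset_spur_powerE (R : realType) (N : nat) (o : 'I_N -> R) (k : nat) :
  offset_spur_power o k =
  (if (k == 0%N) || (k.*2 == N) then 2 else 4) * (N%:R ^-1 ^+ 2 *
    ((\sum_(n < N) cos (dft_angle N k n) * o n) ^+ 2 +
     (\sum_(n < N) sin (dft_angle N k n) * o n) ^+ 2)).
Proof. by rewrite /offset_spur_power normc_dft_sqr. Qed.

Section spur_power_law.
Context (R : realType) (d : measure_display) (T : measurableType d)
  (P : probability T R) (N : nat) (sigma : R).
Hypotheses (N0 : (0 < N)%N) (sigma0 : 0 < sigma).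
Variable o : 'I_N -> {RV P >-> R}.
Hypotheses (o_indep : mutually_independent o)
  (o_gauss : forall n, gaussian_rv 0 sigma (o n)).
Let V : measurableType _ := measurableTypeR R.
Local Notation gamma := (@normal_prob R 0 sigma).

(** The joint law applied to a sublevel set of a multiple of the squared norm; [c] is left free to
    serve both normalisations of the spur power. *)
Lemma gaussian_sum_sqr_le (a b : 'I_N -> R) (c p : R) :
  exists al be ga : R,
  [/\ al ^+ 2 = \sum_n a n ^+ 2, al * be = \sum_n a n * b n,
      be ^+ 2 + ga ^+ 2 = \sum_n b n ^+ 2 &
  P [set t | c * ((\sum_n a n * o n t) ^+ 2 + (\sum_n b n * o n t) ^+ 2) <= p] =
  (\int[gamma]_x \int[gamma]_y
    ((c * ((al * x) ^+ 2 + (be * x + ga * y) ^+ 2) <= p)%R%:R : R)%:E)%E].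
Proof.
have [al [be [ga [aa ab bb H]]]] :=
  gaussian_combination (lt0r_neq0 sigma0) o_indep o_gauss a b.
exists al, be, ga; split => //.
pose A : set (V * V) := [set q | c * (q.1 ^+ 2 + q.2 ^+ 2) <= p].
have mA : measurable A.
  rewrite -[A]setTI; apply: measurable_fun_le => //.
  apply: measurable_funM => //.
  by apply: measurable_funD; exact: measurable_funX.
transitivity (\int[gamma]_x \int[gamma]_y
    (\1_A ((al * x)%R, (be * x + ga * y)%R))%:E)%E; first exact: (H A mA).
have inA q : (q \in A) = (c * (q.1 ^+ 2 + q.2 ^+ 2) <= p).
  by apply/idP/idP; rewrite inE.
by apply: eq_integral => x _; apply: eq_integral => y _; rewrite indicE inA.
Qed.

(** The sines vanish and the squared cosines are 1, so the Gram matrix is [diag(N, 0)] and the power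
    is distributed as [2 x^2 / N]. *)
Lemma spur_power_real_bin (k : nat) (p : R) : 0 <= p ->
  k = 0%N \/ k.*2 = N ->
  P [set t | offset_spur_power (fun n => o n t) k <= p] =
  (erf (Num.sqrt (N%:R * p / (4 * sigma ^+ 2))))%:E.
Proof.
move=> p0 kE.
have Ngt0 : 0 < N%:R :> R by rewrite ltr0n.
have Np0 : 0 <= N%:R * p / 2 by rewrite divr_ge0// mulr_ge0.
have sin0 n : sin (dft_angle N k n) = 0 :> R.
  case: kE => [->|kN]; first by rewrite dft_angle0 sin0.
  by rewrite -kN sin_dft_angle_half// -double_gt0 kN.
have [al [be [ga [aa _ bb PE]]]] := gaussian_sum_sqr_le
  (fun n => cos (dft_angle N k n)) (fun n => sin (dft_angle N k n))
  (2 * N%:R^-1 ^+ 2) p.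
have al2 : al ^+ 2 = N%:R.
  rewrite aa (eq_bigr (fun=> 1)) ?sumr_const ?card_ord// => n _.
  by rewrite cos2sin2 sin0 expr0n subr0.
(* The sine combination has zero variance, which forces both of its coefficients to vanish. *)
have [be0 ga0] : be = 0 /\ ga = 0.
  have /eqP : be ^+ 2 + ga ^+ 2 = 0.
    by rewrite bb big1// => n _; rewrite sin0 expr0n.
  by rewrite paddr_eq0 ?sqr_ge0// !sqrf_eq0 => /andP[/eqP -> /eqP ->].
transitivity (\int[gamma]_x ((x ^+ 2 <= N%:R * p / 2)%R%:R : R)%:E)%E; last first.
  rewrite (normal_sqr_le sigma0 Np0).
  by congr (erf (Num.sqrt _))%:E; field; rewrite gt_eqF.
transitivity (\int[gamma]_x \int[gamma]_y ((x ^+ 2 <= N%:R * p / 2)%R%:R : R)%:E)%E;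
  last by apply: eq_integral => x _; exact: integral_normal_cst.
have kE' : (k == 0%N) || (k.*2 == N) by case: kE => ->; rewrite ?eqxx ?orbT.
rewrite (_ : [set t | _] = [set t | 2 * N%:R^-1 ^+ 2 *
    ((\sum_(n < N) cos (dft_angle N k n) * o n t) ^+ 2 +
     (\sum_(n < N) sin (dft_angle N k n) * o n t) ^+ 2) <= p]); last first.
  by apply/seteqP; split => t /=; rewrite offset_spur_powerE kE' mulrA.
rewrite PE; apply: eq_integral => x _; apply: eq_integral => y _.
rewrite be0 ga0 !mul0r addr0 expr0n addr0 exprMn al2; congr ((_ : bool)%:R%:E).
have -> : 2 * N%:R^-1 ^+ 2 * (N%:R * x ^+ 2) = x ^+ 2 * 2 / N%:R.
  by field; rewrite gt_eqF.
by rewrite ler_pdivrMr// ler_pdivlMr// [p * _]mulrC.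
Qed.

(** The Gram matrix is [diag(N/2, N/2)], so the power is distributed as [2 (x^2 + y^2) / N] and the
    event is a disk. *)
Lemma spur_power_complex_bin (k : nat) (p : R) : 0 <= p ->
  (0 < k)%N -> (k.*2 < N)%N ->
  P [set t | offset_spur_power (fun n => o n t) k <= p] =
  (1 - expR (- (N%:R * p / (4 * sigma ^+ 2))))%:E.
Proof.
move=> p0 k0 kN.
have Ngt0 : 0 < N%:R :> R by rewrite ltr0n.
have Np0 : 0 <= N%:R * p / 2 by rewrite divr_ge0// mulr_ge0.
have [al [be [ga [aa ab bb PE]]]] := gaussian_sum_sqr_le
  (fun n => cos (dft_angle N k n)) (fun n => sin (dft_angle N k n))
  (4 * N%:R^-1 ^+ 2) p.
rewrite sum_cos_sqr// in aa; rewrite sum_cos_sin// in ab.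
rewrite sum_sin_sqr// in bb.
have al0 : al != 0 by rewrite -sqrf_eq0 aa mulf_neq0// gt_eqF.
(* Orthogonality of the cosine and sine vectors gives [al be = 0], and [al^2 = N / 2] is nonzero. *)
have be0 : be = 0.
  by move/eqP: ab; rewrite mulf_eq0 (negbTE al0) => /eqP.
rewrite be0 expr0n add0r in bb.
transitivity (\int[gamma]_x \int[gamma]_y
    ((x ^+ 2 + y ^+ 2 <= N%:R * p / 2)%R%:R : R)%:E)%E; last first.
  rewrite (normal_disk sigma0 Np0).
  by congr (1 - expR _)%:E; field; rewrite gt_eqF.
have kE' : (k == 0%N) || (k.*2 == N) = false.
  by rewrite (ltn_eqF kN) orbF eqn0Ngt k0.
rewrite (_ : [set t | _] = [set t | 4 * N%:R^-1 ^+ 2 *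
    ((\sum_(n < N) cos (dft_angle N k n) * o n t) ^+ 2 +
     (\sum_(n < N) sin (dft_angle N k n) * o n t) ^+ 2) <= p]); last first.
  by apply/seteqP; split => t /=; rewrite offset_spur_powerE kE' mulrA.
rewrite PE; apply: eq_integral => x _; apply: eq_integral => y _.
rewrite be0 mul0r add0r !exprMn aa bb -mulrDr; congr ((_ : bool)%:R%:E).
have -> : 4 * N%:R^-1 ^+ 2 * (N%:R / 2 * (x ^+ 2 + y ^+ 2)) =
    (x ^+ 2 + y ^+ 2) * 2 / N%:R by field; rewrite gt_eqF.
by rewrite ler_pdivrMr// ler_pdivlMr// [p * _]mulrC.
Qed.

End spur_power_law.

Theorem mainTheorem5 (R : realType) (d : measure_display)
    (T : measurableType d) (P : probability T R)
    (N : nat) (hN : (1 <= N)%N)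
    (sigma : R) (hsigma : 0 < sigma)
    (o : 'I_N -> {RV P >-> R})
    (o_indep : mutually_independent o)
    (o_gauss : forall n : 'I_N, gaussian_rv 0 sigma (o n))
    (p : R) (hp : 0 <= p) :
  (forall k : nat, k = 0%N \/ (~~ odd N /\ k = N./2) ->
    P [set t | offset_spur_power (fun n => o n t) k <= p] =
    (erf (Num.sqrt (N%:R * p / (4 * sigma ^+ 2))))%:E)
  /\
  (forall k : nat, (0 < k)%N -> (k.*2 < N)%N ->
    P [set t | offset_spur_power (fun n => o n t) k <= p] =
    (1 - expR (- (N%:R * p / (4 * sigma ^+ 2))))%:E).
Proof.
split=> k.
- move=> kE; apply: spur_power_real_bin => //.
  case: kE => [->|[oddN ->]]; [by left|right].
  (* Evenness of [N] makes twice its integer half equal to [N]. *)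
  exact: even_halfK.
- exact: spur_power_complex_bin.
Qed.
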